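(* Let $A:\mathbb{R}^n\to\mathbb{R}^m$ be linear, let $f:\mathbb{R}^n\to\mathbb{R}\cup\{\infty\}$ be proper, closed and strongly convex with modulus $\mu_f>0$, let $g:\mathbb{R}^m\to\mathbb{R}\cup\{\infty\}$ be proper, closed and convex, with $A\,\mathrm{dom}\, f\cap\mathrm{dom}\, g\neq\emptyset$. Let $x_\star$ be the unique minimizer of $f+g\circ A$ and let $\psi(y)=f^*(-A^\top y)+g^*(y)$. Suppose that (i) $0\in\mathrm{int}(\mathrm{dom}\, g-A\,\mathrm{dom}\, f)$; (ii) $0\in\mathrm{ri}\,\partial(f+g\circ A)(x_\star)$ (strict complementarity); and that $\partial f$ is calm at $x_\star$ and $\partial g$ is calm at $Ax_\star$. Let $(x^k),(y^k)$ be generated by the algorithm NAMA (described in the context), with $\gamma\in(0,\mu_f/\|A\|^2)$, $\beta\in(0,1)$, any $y^0\in\mathbb{R}^m$ and any choice of directions $d^k\in\mathbb{R}^m$. Then eventually $\psi(y^k)\to\inf\psi$ with Q-linear rate and $x^k\to x_\star$ with R-linear rate.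
   Context: $\|A\|$ is the operator norm, $A^\top$ the adjoint; $h^*$ is the Fenchel conjugate; $\partial$ is the convex subdifferential; $\mathrm{ri}$ is the relative interior; strong convexity of $f$ with modulus $\mu_f$ means $f-\frac{\mu_f}{2}\|\cdot\|^2$ is convex. Calmness: a multivalued mapping $F:\mathbb{R}^p\rightrightarrows\mathbb{R}^q$ is calm at $\bar y$ for $\bar x\in F(\bar y)$ if there is a neighborhood $U$ of $\bar x$ such that $F(y)\cap U\subseteq F(\bar y)+O(\|y-\bar y\|)$ for all $y\in\mathbb{R}^p$ (i.e. there is $\kappa\ge0$ such that every point of $F(y)\cap U$ is within distance $\kappa\|y-\bar y\|$ of $F(\bar y)$). $F$ is calm at $\bar y$ if it is calm at $\bar y$ for all $\bar x\in F(\bar y)$. Augmented Lagrangian: $\mathcal{L}_\gamma(x,z,y)=f(x)+g(z)+\langle y,Ax-z\rangle+\frac{\gamma}{2}\|Ax-z\|^2$. Algorithm NAMA. Given $y^0\in\mathbb{R}^m$, $\gamma\in(0,\mu_f/\|A\|^2)$, $\beta\in(0,1)$, for $k=0,1,2,\dots$: 1. $x^k=\arg\min_x\{f(x)+\langle y^k,Ax\rangle\}$, $z^k=\arg\min_z\mathcal{L}_\gamma(x^k,z,y^k)$. 2. Choose a direction $d^k\in\mathbb{R}^m$. 3. Find the largest $\tau_k=\beta^{i_k}$, $i_k\in\{0,1,2,\dots\}$, such that $\mathcal{L}_\gamma(\tilde x^k,\tilde z^k,\tilde y^k)\ge\mathcal{L}_\gamma(x^k,z^k,y^k)$, where $\tilde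 y^k=y^k+\tau_kd^k+\gamma(1-\tau_k)(Ax^k-z^k)$, $\tilde x^k=\arg\min_x\{f(x)+\langle\tilde y^k,Ax\rangle\}$, $\tilde z^k=\arg\min_z\mathcal{L}_\gamma(\tilde x^k,z,\tilde y^k)$. 4. $y^{k+1}=\tilde y^k+\gamma(A\tilde x^k-\tilde z^k)$. Such a $\tau_k$ exists whenever $Ax^k\neq z^k$; if $Ax^k=z^k$ then $(x^k,y^k)$ is already a primal-dual solution. The statement concerns infinite sequences generated by the algorithm. Rates: ''eventually Q-linear'' for $\psi(y^k)$ means there are $c\in(0,1)$ and $\bar k$ with $\psi(y^{k+1})-\inf\psi\le c(\psi(y^k)-\inf\psi)$ for all $k\ge\bar k$; $x^k\to x_\star$ R-linearly means $\|x^k-x_\star\|$ is (eventually) bounded by a sequence converging Q-linearly to $0$. *)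

(* Defs.v *)
From mathcomp Require Import all_boot all_order all_algebra.
From mathcomp Require Import all_classical all_reals all_analysis.

Set Implicit Arguments.
Unset Strict Implicit.
Unset Printing Implicit Defensive.

Import Order.TTheory GRing.Theory Num.Theory.
Import numFieldNormedType.Exports.

Local Open Scope classical_set_scope.
Local Open Scope ring_scope.

Section Euclidean.
Context {R : realType}.

Definition dot n (u v : 'cV[R]_n) : R := \sum_i u i 0 * v i 0.

(* The library norm on matrices is the max norm, hence a separate Euclidean
   norm; the two induce the same topology, so nbhs, interior and
   lower_semicontinuous below are the library ones. *)
Definition enorm n (u : 'cV[R]_n) : R := Num.sqrt (dot u u).

Definition opnorm m n (A : 'M[R]_(m, n)) : R :=
  sup [set enorm (A *m x) | x in [set x : 'cV[R]_n | enorm x <= 1]].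

Definition affine_set n (S : set 'cV[R]_n) : Prop :=
  forall (x y : 'cV[R]_n) (t : R), S x -> S y -> S ((1 - t) *: x + t *: y).

Definition affine_hull n (C : set 'cV[R]_n) : set 'cV[R]_n :=
  \bigcap_(S in [set S | affine_set S /\ C `<=` S]) S.

Definition relint n (C : set 'cV[R]_n) : set 'cV[R]_n :=
  [set x | C x /\ exists2 U, nbhs x U & U `&` affine_hull C `<=` C].

End Euclidean.

Section ConvexAnalysis.
Context {R : realType}.
Local Open Scope ereal_scope.

Definition dom n (h : 'cV[R]_n -> \bar R) : set 'cV[R]_n := [set x | h x < +oo].

Definition proper_fun n (h : 'cV[R]_n -> \bar R) : Prop :=
  (forall x, -oo < h x) /\ dom h !=set0.

(* Meant for functions that never take the value -oo, so that the right-hand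
   side never has the form +oo - oo. *)
Definition convex_efun n (h : 'cV[R]_n -> \bar R) : Prop :=
  forall (x y : 'cV[R]_n) (t : R), (0 < t < 1)%R ->
    h ((1 - t) *: x + t *: y)%R <= (1 - t)%R%:E * h x + t%:E * h y.

Definition strongly_convex n (mu : R) (h : 'cV[R]_n -> \bar R) : Prop :=
  convex_efun (fun x => h x - (mu / 2 * enorm x ^+ 2)%R%:E).

Definition fenchel n (h : 'cV[R]_n -> \bar R) (y : 'cV[R]_n) : \bar R :=
  ereal_sup [set (dot y x)%:E - h x | x in [set: 'cV[R]_n]].

(* For proper h this is empty outside dom h. *)
Definition subdiff n (h : 'cV[R]_n -> \bar R) (x : 'cV[R]_n) : set 'cV[R]_n :=
  [set v | forall x', h x + (dot v (x' - x)%R)%:E <= h x'].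

Definition argmin n (h : 'cV[R]_n -> \bar R) : set 'cV[R]_n :=
  [set x | forall x', h x <= h x'].

Definition calm_at_for p q (F : 'cV[R]_p -> set 'cV[R]_q)
    (ybar : 'cV[R]_p) (xbar : 'cV[R]_q) : Prop :=
  exists2 U, nbhs xbar U &
  exists2 kappa : R, (0 <= kappa)%R &
    forall y x, (F y `&` U) x ->
      exists2 x', F ybar x' & (enorm (x - x') <= kappa * enorm (y - ybar))%R.

Definition calm_at p q (F : 'cV[R]_p -> set 'cV[R]_q) (ybar : 'cV[R]_p) : Prop :=
  forall xbar, F ybar xbar -> calm_at_for F ybar xbar.

End ConvexAnalysis.

Section Rates.
Context {R : realType}.
Local Open Scope ereal_scope.

(* One-sided: used for sequences that are eventually above their limit. *)
Definition Qlinear_cvg (u : nat -> \bar R) (l : \bar R) : Prop :=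
  u @ \oo --> l /\
  exists2 c : R, (0 < c < 1)%R &
  exists kbar : nat, forall k, (kbar <= k)%N ->
    u k.+1 - l <= c%:E * (u k - l).

Definition Rlinear_cvg n (x : nat -> 'cV[R]_n) (l : 'cV[R]_n) : Prop :=
  exists2 r : nat -> R, Qlinear_cvg (fun k => (r k)%:E) 0 &
  exists kbar : nat, forall k, (kbar <= k)%N -> (enorm (x k - l) <= r k)%R.

End Rates.

Section NAMA.
Context {R : realType} {n m : nat}.
Variables (A : 'M[R]_(m, n)) (f : 'cV[R]_n -> \bar R) (g : 'cV[R]_m -> \bar R).
Local Open Scope ereal_scope.

Definition primal_fun (x : 'cV[R]_n) : \bar R := f x + g (A *m x)%R.

Definition dual_fun (y : 'cV[R]_m) : \bar R :=
  fenchel f (- (A^T *m y))%R + fenchel g y.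

Variables (gamma beta : R).

Definition augL (x : 'cV[R]_n) (z y : 'cV[R]_m) : \bar R :=
  f x + g z + (dot y (A *m x - z) + gamma / 2 * enorm (A *m x - z) ^+ 2)%R%:E.

Definition primal_update (y : 'cV[R]_m) (x : 'cV[R]_n) (z : 'cV[R]_m) : Prop :=
  argmin (fun x' => f x' + (dot y (A *m x'))%:E) x /\
  argmin (fun z' => augL x z' y) z.

Definition accepted (y d : 'cV[R]_m) (x : 'cV[R]_n) (z : 'cV[R]_m) (tau : R)
    (yt : 'cV[R]_m) (xt : 'cV[R]_n) (zt : 'cV[R]_m) : Prop :=
  [/\ yt = (y + tau *: d + (gamma * (1 - tau)) *: (A *m x - z))%R,
      primal_update yt xt zt &
      augL x z y <= augL xt zt yt].

Record NAMA_step (y d : 'cV[R]_m) (x : 'cV[R]_n) (z : 'cV[R]_m) (tau : R)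
    (yt : 'cV[R]_m) (xt : 'cV[R]_n) (zt y' : 'cV[R]_m) : Prop := {
  NAMA_primal : primal_update y x z;
  NAMA_tau_pow : exists i : nat, tau = (beta ^+ i)%R;
  NAMA_accepted : accepted y d x z tau yt xt zt;
  NAMA_tau_largest : forall (j : nat) yt' xt' zt',
    accepted y d x z (beta ^+ j)%R yt' xt' zt' -> (beta ^+ j <= tau)%R;
  NAMA_dual : y' = (yt + gamma *: (A *m xt - zt))%R }.

Definition NAMA (y d : nat -> 'cV[R]_m) (x : nat -> 'cV[R]_n)
    (z : nat -> 'cV[R]_m) (tau : nat -> R) (yt : nat -> 'cV[R]_m)
    (xt : nat -> 'cV[R]_n) (zt : nat -> 'cV[R]_m) : Prop :=
  forall k, NAMA_step (y k) (d k) (x k) (z k) (tau k)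
                      (yt k) (xt k) (zt k) (y k.+1).

End NAMA.

(* Main.v *)
Require Import Defs.
From mathcomp Require Import all_boot all_order all_algebra.
From mathcomp Require Import all_classical all_reals all_analysis.
From mathcomp Require Import ring lra.
Import Order.TTheory GRing.Theory Num.Theory.
Import numFieldNormedType.Exports.
Local Open Scope classical_set_scope.
Local Open Scope ring_scope.

Set Implicit Arguments.
Unset Strict Implicit.
Unset Printing Implicit Defensive.

(** The point [yt k] is mapped to [y k.+1] by a proximal gradient step on the
    dual function psi, and minus the augmented Lagrangian is the
    forward-backward envelope of psi: it is below psi, and a proximal gradient
    step brings psi below it by a multiple of [|r|^2], where
    [r = A xt - zt] is the residual. The acceptance test therefore makes psi
    decrease by at least [c |r|^2] at each iteration, whatever the directions.

    It remains to bound the gap [psi(y) - inf psi] by [C |r|^2]. If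
    [- A^T y] is a subgradient of [f] at [x] and [y] one of [g] at [z], the gap is
    at most [|y - y*| |z - A x|] for each dual solution [y*] and at least
    [mu/2 |x - xstar|^2]. The dual solutions are the [y] in the subdifferential
    of [g] at [A xstar] with [- A^T y] in that of [f] at [xstar]. Calmness bounds
    the distances to these two sets by [|x - xstar| + |z - A x|] up to a constant,
    and strict complementarity turns this into a bound on the distance to their
    intersection. Choosing [y*] accordingly, [|y - y*|] is
    [O(|z - A x|)] near each dual solution; a compactness argument makes the
    bound uniform on a sublevel set, which is bounded by the qualification
    condition. *)

(** * Euclidean norm *)

Section EuclideanTheory.
Context {R : realType}.
Implicit Types n m : nat.

Lemma dotC n (u v : 'cV[R]_n) : dot u v = dot v u.
Proof. by apply: eq_bigr => i _; rewrite mulrC. Qed.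

Lemma dotDl n (u v w : 'cV[R]_n) : dot (u + v) w = dot u w + dot v w.
Proof.
by rewrite -big_split /=; apply: eq_bigr => i _; rewrite mxE mulrDl.
Qed.

Lemma dotZl n (a : R) (u v : 'cV[R]_n) : dot (a *: u) v = a * dot u v.
Proof.
by rewrite /dot mulr_sumr; apply: eq_bigr => i _; rewrite mxE mulrA.
Qed.

Lemma dotNl n (u v : 'cV[R]_n) : dot (- u) v = - dot u v.
Proof. by rewrite -scaleN1r dotZl mulN1r. Qed.

Lemma dotDr n (u v w : 'cV[R]_n) : dot w (u + v) = dot w u + dot w v.
Proof. by rewrite dotC dotDl !(dotC w). Qed.

Lemma dotZr n (a : R) (u v : 'cV[R]_n) : dot v (a *: u) = a * dot v u.
Proof. by rewrite dotC dotZl dotC. Qed.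

Lemma dotNr n (u v : 'cV[R]_n) : dot v (- u) = - dot v u.
Proof. by rewrite dotC dotNl dotC. Qed.

Lemma dot0l n (v : 'cV[R]_n) : dot 0 v = 0.
Proof. by rewrite -(scale0r 0) dotZl mul0r. Qed.

Lemma dot0r n (v : 'cV[R]_n) : dot v 0 = 0.
Proof. by rewrite dotC dot0l. Qed.

Definition dotE := (dotDl, dotDr, dotNl, dotNr, dotZl, dotZr).

Lemma dot_trmx n m (A : 'M[R]_(m, n)) (y : 'cV[R]_m) (x : 'cV[R]_n) :
  dot (A^T *m y) x = dot y (A *m x).
Proof.
have dotM k (u v : 'cV[R]_k) : dot u v = (u^T *m v) 0 0.
  by rewrite mxE; apply: eq_bigr => i _; rewrite mxE.
by rewrite !dotM trmx_mul trmxK mulmxA.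
Qed.

Lemma dot_delta n (i : 'I_n) (v : 'cV[R]_n) : dot v (delta_mx i 0) = v i 0.
Proof.
rewrite /dot (bigD1 i) //= big1 ?addr0 => [|j ji].
  by rewrite mxE !eqxx mulr1.
by rewrite mxE (negbTE ji) mulr0.
Qed.

Lemma dot_ge0 n (u : 'cV[R]_n) : 0 <= dot u u.
Proof. by apply: sumr_ge0 => i _; rewrite -expr2 sqr_ge0. Qed.

Lemma enorm_ge0 n (u : 'cV[R]_n) : 0 <= enorm u.
Proof. exact: sqrtr_ge0. Qed.

Lemma enorm_sqr n (u : 'cV[R]_n) : enorm u ^+ 2 = dot u u.
Proof. exact/sqr_sqrtr/dot_ge0. Qed.

Lemma enorm0 n : enorm (0 : 'cV[R]_n) = 0.
Proof. by rewrite /enorm dot0l sqrtr0. Qed.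

Lemma enormN n (u : 'cV[R]_n) : enorm (- u) = enorm u.
Proof. by rewrite /enorm dotNl dotNr opprK. Qed.

Lemma enormB n (u v : 'cV[R]_n) : enorm (u - v) = enorm (v - u).
Proof. by rewrite -enormN opprB. Qed.

Lemma enormZ n (a : R) (u : 'cV[R]_n) : enorm (a *: u) = `|a| * enorm u.
Proof.
by rewrite /enorm dotZl dotZr mulrA -expr2 sqrtrM ?sqr_ge0 // sqrtr_sqr.
Qed.

Lemma coord_le_enorm n (u : 'cV[R]_n) i : `|u i 0| <= enorm u.
Proof.
rewrite -sqrtr_sqr ler_sqrt ?dot_ge0 // /dot (bigD1 i) //= -expr2 lerDl.
by apply: sumr_ge0 => j _; rewrite -expr2 sqr_ge0.
Qed.

Lemma enorm_eq0 n (u : 'cV[R]_n) : enorm u = 0 -> u = 0.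
Proof.
move=> u0; apply/colP => i; rewrite mxE; apply/eqP.
by rewrite -normr_le0 -u0 coord_le_enorm.
Qed.

Lemma dot_le_enorm n (u v : 'cV[R]_n) : dot u v <= enorm u * enorm v.
Proof.
have [u0|u0] := eqVneq (enorm u) 0.
  by rewrite (enorm_eq0 u0) dot0l enorm0 mul0r.
have [v0|v0] := eqVneq (enorm v) 0.
  by rewrite (enorm_eq0 v0) dot0r enorm0 mulr0.
have uv0 : 0 < enorm u * enorm v by rewrite mulr_gt0 // lt0r ?u0 ?v0 enorm_ge0.
(* Expanding this square and dividing by [enorm u * enorm v] gives the Cauchy-Schwarz inequality. *)
have := dot_ge0 (enorm v *: u - enorm u *: v).
rewrite !dotE (dotC v u) -!enorm_sqr => h.
rewrite -(ler_pM2l uv0); nra.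
Qed.

Lemma norm_dot_le n (u v : 'cV[R]_n) : `|dot u v| <= enorm u * enorm v.
Proof.
by rewrite ler_norml dot_le_enorm lerNl -dotNl -(enormN u) dot_le_enorm.
Qed.

Lemma enormD_le n (u v : 'cV[R]_n) : enorm (u + v) <= enorm u + enorm v.
Proof.
rewrite -[leRHS]ger0_norm ?addr_ge0 ?enorm_ge0 // -sqrtr_sqr ler_sqrt ?sqr_ge0 //.
rewrite !dotE (dotC v u) sqrrD !enorm_sqr.
have := dot_le_enorm u v; rewrite mulr2n; lra.
Qed.

Lemma enorm_triangle n (v u w : 'cV[R]_n) :
  enorm (u - w) <= enorm (u - v) + enorm (v - w).
Proof. by have := enormD_le (u - v) (v - w); rewrite addrA subrK. Qed.

Lemma enorm_le_sum n (u : 'cV[R]_n) : enorm u <= \sum_i `|u i 0|.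
Proof.
rewrite -[leRHS]ger0_norm ?sumr_ge0 // -sqrtr_sqr ler_sqrt ?sqr_ge0 //.
rewrite expr2 mulr_suml ler_sum // => i _.
rewrite (le_trans (ler_norm _)) // normrM ler_wpM2l // (bigD1 i) //= lerDl.
exact: sumr_ge0.
Qed.

Lemma enorm_le_const n (u : 'cV[R]_n) (c : R) :
  (forall i, `|u i 0| <= c) -> enorm u <= n%:R * c.
Proof.
move=> uc; apply: (le_trans (enorm_le_sum u)).
by rewrite mulr_natl -[X in _ *+ X]card_ord -sumr_const ler_sum.
Qed.

Lemma nbhs_enorm n (x : 'cV[R]_n) (U : set 'cV[R]_n) :
  nbhs x U -> exists2 e : R, 0 < e & forall y, enorm (y - x) < e -> U y.
Proof.
move=> /nbhs_ballP[e /= e0 eU]; exists e => // y yx; apply: eU.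
split=> // i j; rewrite (ord1 j) /ball/= distrC.
by apply: le_lt_trans yx; have := coord_le_enorm (y - x) i; rewrite !mxE.
Qed.

Lemma enorm_ball_nbhs n (x : 'cV[R]_n) (e : R) : 0 < e ->
  nbhs x [set y | enorm (y - x) < e].
Proof.
(* The library ball bounds each of the [n] coordinates. Dividing by [n.+1] makes their sum strictly
   less than [e] and also covers [n = 0]. *)
move=> e0; have d0 : 0 < e / n.+1%:R by rewrite divr_gt0.
apply/nbhs_ballP; exists (e / n.+1%:R) => //= y [_ yx].
have h : enorm (y - x) <= n%:R * (e / n.+1%:R).
  apply: enorm_le_const => i; rewrite !mxE distrC.
  exact/ltW/(yx i 0).
apply: (le_lt_trans h); rewrite mulrCA gtr_pMr //.
by rewrite ltr_pdivrMr // mul1r ltr_nat.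
Qed.

Lemma mulmx_enorm_bounded n m (A : 'M[R]_(m, n)) :
  exists2 c : R, 0 <= c & forall x, enorm (A *m x) <= c * enorm x.
Proof.
pose c := \sum_i enorm (row i A)^T; exists c.
  by apply: sumr_ge0 => i _; exact: enorm_ge0.
move=> x; apply: (le_trans (enorm_le_sum _)).
rewrite /c mulr_suml ler_sum // => i _.
have -> : (A *m x) i 0 = dot (row i A)^T x.
  by rewrite mxE; apply: eq_bigr => j _; rewrite !mxE.
exact: norm_dot_le.
Qed.

Lemma opnorm_has_ubound n m (A : 'M[R]_(m, n)) :
  has_ubound [set enorm (A *m u) | u in [set u | enorm u <= 1]].
Proof.
have [c c0 Ac] := mulmx_enorm_bounded A.
exists c => _ [u /= u1 <-]; apply: (le_trans (Ac u)).
by rewrite -[leRHS]mulr1 ler_wpM2l.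
Qed.

Lemma opnorm_ge0 n m (A : 'M[R]_(m, n)) : 0 <= opnorm A.
Proof.
apply: ub_le_sup; first exact: opnorm_has_ubound.
by exists 0; rewrite /= ?mulmx0 enorm0.
Qed.

Lemma opnorm_ub n m (A : 'M[R]_(m, n)) x :
  enorm (A *m x) <= opnorm A * enorm x.
Proof.
have [x0|x0] := eqVneq (enorm x) 0.
  by rewrite x0 mulr0 (enorm_eq0 x0) mulmx0 enorm0.
have xp : 0 < enorm x by rewrite lt0r x0 enorm_ge0.
rewrite -ler_pdivrMr // mulrC.
have -> : (enorm x)^-1 * enorm (A *m x) = enorm (A *m ((enorm x)^-1 *: x)).
  by rewrite -scalemxAr enormZ ger0_norm // invr_ge0 enorm_ge0.
apply: ub_le_sup; first exact: opnorm_has_ubound.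
exists ((enorm x)^-1 *: x) => //=.
by rewrite enormZ ger0_norm ?invr_ge0 ?enorm_ge0 // mulVf.
Qed.

(* [N] serves at once as a constant and as a threshold, so that finitely many
   local statements can be merged by taking [N] large. *)
Lemma enorm_ball_covering m (B : R) (P : nat -> 'cV[R]_m -> Prop) :
  (forall y0, exists e N0, 0 < e /\
    forall N y, (N0 <= N)%N -> enorm (y - y0) < e -> P N y) ->
  exists N, forall y, enorm y <= B -> P N y.
Proof.
move=> locP.
have cK : compact [set v : 'rV[R]_m | forall i, `[- B, B]%classic (v ord0 i)].
  by apply: (@rV_compact _ _ (fun=> `[- B, B]%classic)) => i; exact: segment_compact.
(* On a compact set, a property that holds for large [N] near each point holds for large [N]
   uniformly. The box contains the ball of radius [B]. *)
move/compact_near_coveringP : cK => /(_ nat \oo (fun N v => P N v^T)).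
case=> [v _|N _ NP].
  have [e [N0 [e0 eP]]] := locP v^T.
  have tr_cont : nbhs v [set w : 'rV[R]_m | enorm (w^T - v^T) < e].
    have [d /= d0 dU] := (iffLR (nbhs_ballP _ _) (enorm_ball_nbhs v^T e0)).
    apply/nbhs_ballP; exists d => //= w [_ wv]; apply: dU; split=> // i j.
    by rewrite !mxE; exact: wv.
  exists ([set w : 'rV[R]_m | enorm (w^T - v^T) < e], [set N | (N0 <= N)%N]) => /=.
    by split=> //; exists N0.
  by case=> w N /= [wv NN0]; exact: eP.
exists N => y yB; rewrite -(trmxK y); apply: (NP N _ y^T) => /=; first exact: leqnn.
move=> i; rewrite mxE in_itv /= -ler_norml.
exact: le_trans (coord_le_enorm y i) yB.
Qed.

End EuclideanTheory.

(** * Real-valued convex analysis *)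

Section ConvexTheory.
Context {R : realType}.

(** This is the limit [t -> 0]. It serves after an inequality along a segment has been divided by
    the step [t]. *)
Lemma ler_of_small_slack (a b c : R) :
  (forall t, 0 < t < 1 -> a <= b + t * c) -> a <= b.
Proof.
move=> h; apply/ler_addgt0Pr => e e0.
pose t := e / (e + `|c| + 1).
have ep : 0 < e + `|c| + 1 by rewrite ltr_wpDl // addr_ge0 // ltW.
have t01 : 0 < t < 1.
  rewrite divr_gt0 //= ltr_pdivrMr // mul1r -addrA ltrDl.
  by rewrite ltr_wpDl.
apply: (le_trans (h t t01)); rewrite lerD2l.
case/andP: t01 => t0 _.
apply: (@le_trans _ _ (t * `|c|)); first by rewrite ler_pM2l // ler_norm.
rewrite mulrAC ler_pdivrMr // ler_pM2l //.
by rewrite addrAC lerDr addr_ge0 // ltW.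
Qed.

Lemma proper_fineE n (h : 'cV[R]_n -> \bar R) u :
  proper_fun h -> dom h u -> h u = (fine (h u))%:E.
Proof.
move=> [hNy _] hu; rewrite fineK // fin_real //.
by rewrite hNy; exact: hu.
Qed.

(** Since [h] is finite somewhere, a point with a subgradient has finite value, and points outside
    the domain impose no constraint. Later arguments can thus stay in the reals. *)
Lemma subdiffP n (h : 'cV[R]_n -> \bar R) x v : proper_fun h ->
  subdiff h x v <->
  dom h x /\ forall u, dom h u -> fine (h x) + dot v (u - x) <= fine (h u).
Proof.
move=> hp; split=> [sub|[hx sub] u].
  have hx : dom h x.
    have [_ [u hu]] := hp; have := sub u; rewrite (proper_fineE hp hu) /dom /=.
    by case: (h x) => [r||] //=; rewrite ltry.
  split=> // u hu; have := sub u.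
  by rewrite (proper_fineE hp hx) (proper_fineE hp hu) -EFinD lee_fin.
have [hu|] := pselect (dom h u); last first.
  by rewrite /dom /= => /negP; rewrite -leNgt leye_eq => /eqP ->; rewrite leey.
by rewrite (proper_fineE hp hx) (proper_fineE hp hu) -EFinD lee_fin sub.
Qed.

Lemma convex_fine n (h : 'cV[R]_n -> \bar R) u v t :
  proper_fun h -> convex_efun h -> dom h u -> dom h v -> 0 < t < 1 ->
  dom h ((1 - t) *: u + t *: v) /\
  fine (h ((1 - t) *: u + t *: v)) <= (1 - t) * fine (h u) + t * fine (h v).
Proof.
move=> hp hc hu hv t01; have := hc u v t t01.
rewrite (proper_fineE hp hu) (proper_fineE hp hv) -!EFinM -EFinD => le_h.
have hw : dom h ((1 - t) *: u + t *: v) by apply: le_lt_trans le_h _; exact: ltry.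
by split=> //; rewrite -lee_fin -(proper_fineE hp hw).
Qed.

Lemma strongly_convex_fine n (mu : R) (h : 'cV[R]_n -> \bar R) u v t :
  proper_fun h -> strongly_convex mu h -> dom h u -> dom h v -> 0 < t < 1 ->
  dom h ((1 - t) *: u + t *: v) /\
  fine (h ((1 - t) *: u + t *: v)) <=
    (1 - t) * fine (h u) + t * fine (h v)
    - mu / 2 * t * (1 - t) * enorm (u - v) ^+ 2.
Proof.
move=> hp hc hu hv t01.
pose h' := (fun x => h x - (mu / 2 * enorm x ^+ 2)%R%:E)%E.
have dom_h' w : dom h w -> dom h' w.
  by move=> hw; rewrite /dom /= /h' (proper_fineE hp hw) -EFinB ltry.
have dom_h'r w : dom h' w -> dom h w.
  have [hNy _] := hp; have := hNy w.
  by rewrite /dom /= /h'; case: (h w) => [r||] //=; rewrite !ltry.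
have fine_h' w : dom h w -> fine (h' w) = fine (h w) - mu / 2 * enorm w ^+ 2.
  by move=> hw; rewrite /h' (proper_fineE hp hw) -EFinB.
have hp' : proper_fun h'.
  have [hNy [w hw]] := hp; split; last by exists w; exact: dom_h'.
  move=> x; rewrite /h'; move: (hNy x).
  by case: (h x) => [r||] //= _; rewrite -EFinB ltNyr.
have [hw] := convex_fine hp' hc (dom_h' _ hu) (dom_h' _ hv) t01.
have {}hw := dom_h'r _ hw; rewrite !fine_h' // => le_h; split=> //.
(* The quadratic terms combine by [(1-t)|u|^2 + t|v|^2 - |(1-t)u + tv|^2 = t(1-t)|u-v|^2]. *)
move: le_h; rewrite !enorm_sqr !dotE (dotC v u); nra.
Qed.

(** The subgradient inequality at [x + t(u - x)], combined with strong convexity on the segment and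
    divided by [t], gives the claim up to [t * mu/2 |u - x|^2]. *)
Lemma subdiff_strong n (mu : R) (h : 'cV[R]_n -> \bar R) x v u :
  proper_fun h -> strongly_convex mu h -> subdiff h x v -> dom h u ->
  fine (h x) + dot v (u - x) + mu / 2 * enorm (u - x) ^+ 2 <= fine (h u).
Proof.
move=> hp hc /(subdiffP _ _ hp)[hx sub] hu.
apply: (@ler_of_small_slack _ _ (mu / 2 * enorm (u - x) ^+ 2)) => t t01.
have [hw le_w] := strongly_convex_fine hp hc hx hu t01.
have := sub _ hw.
have -> : (1 - t) *: x + t *: u - x = t *: (u - x).
  by apply/colP => i; rewrite !mxE; ring.
rewrite dotZr => le_s; rewrite (enormB x u) in le_w.
by case/andP: t01 => t0 t1; rewrite -(ler_pM2l t0); nra.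
Qed.

Lemma fenchel_ub n (h : 'cV[R]_n -> \bar R) y M : proper_fun h ->
  (forall u, dom h u -> dot y u - fine (h u) <= M) -> (fenchel h y <= M%:E)%E.
Proof.
move=> hp hM; apply: ge_ereal_sup => _ [u _ <-].
have [hu|] := pselect (dom h u); last first.
  by rewrite /dom /= => /negP; rewrite -leNgt leye_eq => /eqP -> /=; rewrite leNye.
by rewrite (proper_fineE hp hu) -EFinB lee_fin hM.
Qed.

Lemma fenchel_lb n (h : 'cV[R]_n -> \bar R) y u : proper_fun h -> dom h u ->
  ((dot y u - fine (h u))%:E <= fenchel h y)%E.
Proof.
move=> hp hu; apply: ereal_sup_ubound; exists u => //.
by rewrite (proper_fineE hp hu) -EFinB.
Qed.

End ConvexTheory.

(** * Fenchel duality and optimality conditions of the updates *)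

Section Duality.
Context {R : realType} {n m : nat}.
Variables (A : 'M[R]_(m, n)) (f : 'cV[R]_n -> \bar R) (g : 'cV[R]_m -> \bar R).
Hypotheses (f_proper : proper_fun f) (g_proper : proper_fun g).

Lemma dual_fun_lb y u v : dom f u -> dom g v ->
  ((dot y (v - A *m u) - fine (f u) - fine (g v))%:E <= dual_fun A f g y)%E.
Proof.
move=> fu gv.
have -> : dot y (v - A *m u) - fine (f u) - fine (g v) =
    (dot (- (A^T *m y)) u - fine (f u)) + (dot y v - fine (g v)).
  by rewrite dotDr dotNr dotNl dot_trmx; ring.
by rewrite EFinD leeD // fenchel_lb.
Qed.

Lemma dual_fun_ub y M1 M2 :
  (forall u, dom f u -> - dot y (A *m u) - fine (f u) <= M1) ->
  (forall v, dom g v -> dot y v - fine (g v) <= M2) ->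
  (dual_fun A f g y <= (M1 + M2)%:E)%E.
Proof.
move=> fM gM; rewrite EFinD leeD // fenchel_ub // => u fu.
by rewrite dotNl dot_trmx fM.
Qed.

(** The two subgradients are the equality cases of the Fenchel-Young inequality, so both suprema in
    psi are attained, at [x] and at [z]. *)
Lemma dual_fun_attained y x z :
  subdiff f x (- (A^T *m y)) -> subdiff g z y ->
  dual_fun A f g y = (dot y (z - A *m x) - fine (f x) - fine (g z))%:E.
Proof.
move=> /(subdiffP _ _ f_proper)[fx fsub] /(subdiffP _ _ g_proper)[gz gsub].
apply/eqP; rewrite eq_le dual_fun_lb // andbT.
have -> : dot y (z - A *m x) - fine (f x) - fine (g z) =
    (- dot y (A *m x) - fine (f x)) + (dot y z - fine (g z)) by rewrite dotDr dotNr; ring.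
apply: dual_fun_ub => [u fu|v gv].
  by have := fsub u fu; rewrite dotNl dot_trmx mulmxBr dotDr dotNr; lra.
by have := gsub v gv; rewrite dotDr dotNr; lra.
Qed.

Lemma argmin_lagrangian_subdiff y x :
  argmin (fun x' => (f x' + (dot y (A *m x'))%:E)%E) x ->
  subdiff f x (- (A^T *m y)).
Proof.
move=> xmin; have [_ [u0 fu0]] := f_proper.
have fx : dom f x.
  have := xmin u0; rewrite (proper_fineE f_proper fu0) -EFinD /dom /=.
  by have [fNy _] := f_proper; move: (fNy x); case: (f x) => [r||] //=; rewrite ltry.
apply/(subdiffP _ _ f_proper); split=> // u fu; have := xmin u.
rewrite (proper_fineE f_proper fu) (proper_fineE f_proper fx) -!EFinD lee_fin.
by rewrite dotNl dot_trmx mulmxBr dotDr dotNr /=; lra.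
Qed.

(** Moving from [z] to [z + t(v - z)] changes the smooth part to first order by [-t] times the
    pairing of [y + gamma(Ax - z)] with [v - z]. The quadratic remainder disappears after division
    by [t]. *)
Lemma argmin_augL_subdiff gamma y x z : convex_efun g -> dom f x ->
  argmin (fun z' => augL A f g gamma x z' y) z ->
  subdiff g z (y + gamma *: (A *m x - z)).
Proof.
move=> g_convex fx zmin; have [gNy [v0 gv0]] := g_proper.
have gz : dom g z.
  have := zmin v0; rewrite /augL (proper_fineE g_proper gv0).
  rewrite (proper_fineE f_proper fx) -!EFinD /dom /=.
  by move: (gNy z); case: (g z) => [r||] //=; rewrite ltry.
apply/(subdiffP _ _ g_proper); split=> // v gv.
apply: (@ler_of_small_slack _ _ _ (gamma / 2 * enorm (v - z) ^+ 2)) => t t01.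
have [gw le_w] := convex_fine g_proper g_convex gz gv t01.
have := zmin ((1 - t) *: z + t *: v); rewrite /augL (proper_fineE f_proper fx).
rewrite (proper_fineE g_proper gw) (proper_fineE g_proper gz) -!EFinD lee_fin.
have -> : A *m x - ((1 - t) *: z + t *: v) = A *m x - z - t *: (v - z).
  by apply/colP => i; rewrite !mxE; ring.
move: (A *m x - z) (v - z) => r e.
rewrite !enorm_sqr !dotE (dotC e r) => le_L.
by case/andP: t01 => t0 t1; rewrite -(ler_pM2l t0); nra.
Qed.

End Duality.

(** * Linear minorants and the sum rule *)

Section LinearMinorant.
Context {R : realType} {m : nat}.
Variables (K : 'cV[R]_m -> R -> Prop) (rho : R).
Hypotheses (rho_gt0 : 0 < rho)
  (K_total : forall w, enorm w < rho -> exists s, K w s).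

Let axis (i : 'I_m) (e : R) : `|e| < rho -> exists s, K (e *: delta_mx i 0) s.
Proof.
move=> e_rho; apply: K_total; rewrite enormZ.
suff -> : enorm (delta_mx i 0 : 'cV[R]_m) = 1 by rewrite mulr1.
by rewrite /enorm dot_delta mxE !eqxx sqrtr1.
Qed.

Let half_lt : `|rho / 2| < rho /\ `|- (rho / 2)| < rho.
Proof. by rewrite normrN gtr0_norm ?divr_gt0 // gtr_pMr // invf_lt1 ?ltr1n. Qed.

(** [K] acts as the epigraph of a function with a finite upper bound at each point of the ball of
    radius [rho]. Testing a minorant [q] at [rho/2] and [-rho/2] times each axis vector bounds every
    coordinate of [q]. *)
Lemma linear_minorant_bounded :
  exists B, forall q, (forall w s, K w s -> dot q w <= s) -> enorm q <= B.
Proof.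
have [sp spP] := choice (fun i => axis i half_lt.1).
have [sn snP] := choice (fun i => axis i half_lt.2).
exists (\sum_i (2 / rho * (`|sp i| + `|sn i|))) => q qK.
apply: (le_trans (enorm_le_sum q)); apply: ler_sum => i _.
have := qK _ _ (spP i); have := qK _ _ (snP i).
rewrite !dotZr dot_delta => hn hp.
rewrite mulrC mulrA ler_pdivlMr //.
have := ler_norm (sp i); have := ler_norm (sn i).
have := normr_ge0 (sp i); have := normr_ge0 (sn i).
by case: (lerP 0 (q i 0)) => q0; rewrite ?(ger0_norm q0) ?(ltr0_norm q0); lra.
Qed.

Hypotheses
  (K_convex : forall w1 s1 w2 s2 t, 0 < t < 1 -> K w1 s1 -> K w2 s2 ->
     K ((1 - t) *: w1 + t *: w2) ((1 - t) * s1 + t * s2))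
  (K_0 : forall s, K 0 s -> 0 <= s).

(* Hahn-Banach, extending the functional one coordinate at a time. *)
Lemma linear_minorant_exists : exists q, forall w s, K w s -> dot q w <= s.
Proof.
(* At stage [j] the bound is only claimed for [w] supported on the first [j] coordinates. *)
suff step j : (j <= m)%N -> exists q, forall w s, K w s ->
    (forall i : 'I_m, (j <= i)%N -> w i 0 = 0) -> dot q w <= s.
  have [q qP] := step m (leqnn m); exists q => w s Kws.
  by apply: qP Kws _ => i; rewrite leqNgt ltn_ord.
elim: j => [|j IH] jm.
  exists 0 => w s Kws w0; rewrite dot0l; apply: K_0.
  suff <- : w = 0 by [].
  by apply/colP => i; rewrite w0 // mxE.
have [q qP] := IH (ltnW jm); pose i0 := Ordinal jm.
pose supp (w : 'cV[R]_m) := forall i : 'I_m, (j < i)%N -> w i 0 = 0.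
(* Points with negative coordinate [i0] give lower bounds on the new coefficient, those with
   positive coordinate upper bounds. The weight [t] cancels coordinate [i0], so the induction
   hypothesis makes these bounds compatible. *)
have pair w1 s1 w2 s2 : K w1 s1 -> supp w1 -> K w2 s2 -> supp w2 ->
    0 < w1 i0 0 -> w2 i0 0 < 0 ->
    (dot q w2 - s2) / - w2 i0 0 <= (s1 - dot q w1) / w1 i0 0.
  move=> K1 S1 K2 S2 w1p w2n; set a := w1 i0 0; set b := - w2 i0 0.
  have a0 : 0 < a by [].
  have b0 : 0 < b by rewrite oppr_gt0.
  have ab0 : a + b != 0 by rewrite gt_eqF ?addr_gt0.
  pose t := a / (a + b).
  have t01 : 0 < t < 1.
    by rewrite divr_gt0 ?addr_gt0 //= ltr_pdivrMr ?addr_gt0 // mul1r ltrDl.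
  have t1E : 1 - t = b / (a + b) by rewrite /t; field.
  have := qP _ _ (K_convex t01 K1 K2).
  rewrite dotDr !dotZr t1E /t => h.
  have : b / (a + b) * dot q w1 + a / (a + b) * dot q w2 <=
         b / (a + b) * s1 + a / (a + b) * s2.
    apply: h => i; rewrite leq_eqVlt !mxE => /predU1P[ji|ji]; last first.
      by rewrite S1 // S2 // !mulr0 addr0.
    have -> : i = i0 by apply: val_inj.
    rewrite -/a -[w2 i0 0]opprK -/b; field.
    exact: ab0.
  rewrite !(mulrAC _ (a + b)^-1) -!mulrDl ler_pM2r ?invr_gt0 ?addr_gt0 // => {}h.
  by rewrite ler_pdivrMr // mulrAC ler_pdivlMr //; lra.
(* The lower bounds on the new coefficient; their supremum is the coefficient chosen. *)
pose L := [set c | exists w s,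
  [/\ K w s, supp w, w i0 0 < 0 & c = (dot q w - s) / - w i0 0]].
have supp_axis e : supp (e *: delta_mx i0 0).
  move=> i ji; rewrite !mxE; case: eqP => [ii|]; last by rewrite mulr0.
  by move: ji; rewrite ii ltnn.
have axisE e : (e *: delta_mx i0 0 : 'cV[R]_m) i0 0 = e.
  by rewrite !mxE !eqxx mulr1.
have [sp Ksp] := axis i0 half_lt.1.
have [sn Ksn] := axis i0 half_lt.2.
have r2 : 0 < rho / 2 by rewrite divr_gt0.
have L_sup : has_sup L.
  split.
    exists ((dot q (- (rho / 2) *: delta_mx i0 0) - sn) / - (- (rho / 2))).
    by exists (- (rho / 2) *: delta_mx i0 0), sn; rewrite axisE oppr_lt0.
  eexists => _ [w [s [Kw Sw wn ->]]].
  by apply: (pair _ _ _ _ Ksp (supp_axis _) Kw Sw) => //; rewrite axisE.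
exists (q + sup L *: delta_mx i0 0) => w s Kw Sw.
rewrite dotDl dotZl (dotC (delta_mx _ _)) dot_delta.
case: (ltrgt0P (w i0 0)) => [wp|wn|w0].
- rewrite -lerBrDl -ler_pdivlMr //; apply: ge_sup; first by have [] := L_sup.
  by move=> _ [w2 [s2 [K2 S2 wn2 ->]]]; apply: pair.
- have : (dot q w - s) / - w i0 0 <= sup L.
    by apply: ub_le_sup; [have [] := L_sup | exists w, s].
  by rewrite ler_pdivrMr ?oppr_gt0 //; lra.
- rewrite w0 mulr0 addr0; apply: qP Kw _ => i; rewrite leq_eqVlt.
  by case/predU1P => [ji|/Sw//]; rewrite -w0; congr (w _ _); apply: val_inj.
Qed.

End LinearMinorant.

Section SumRule.
Context {R : realType} {n m : nat}.
Variables (A : 'M[R]_(m, n)) (f : 'cV[R]_n -> \bar R) (g : 'cV[R]_m -> \bar R).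
Hypotheses (f_proper : proper_fun f) (g_proper : proper_fun g).

Lemma subdiff_convex k (h : 'cV[R]_k -> \bar R) x p p' t :
  proper_fun h -> 0 < t < 1 -> subdiff h x p -> subdiff h x p' ->
  subdiff h x ((1 - t) *: p + t *: p').
Proof.
move=> hp /andP[t0 t1] /(subdiffP _ _ hp)[hx ps] /(subdiffP _ _ hp)[_ ps'].
apply/(subdiffP _ _ hp); split=> // u hu.
have := ps u hu; have := ps' u hu; rewrite dotDl !dotZl => h1 h2.
rewrite -subr_ge0 in h1; rewrite -subr_ge0 in h2.
have := mulr_ge0 (ltW t0) h1.
have t1' : 0 <= 1 - t by rewrite subr_ge0 ltW.
have := mulr_ge0 t1' h2; lra.
Qed.

Lemma strongly_convex_convex k (h : 'cV[R]_k -> \bar R) mu :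
  proper_fun h -> 0 <= mu -> strongly_convex mu h -> convex_efun h.
Proof.
move=> hp mu0 hc u v t t01; have /andP[t0 t1] := t01.
have t1' : 0 < 1 - t by rewrite subr_gt0.
have inf w : ~ dom h w -> h w = +oo%E.
  by rewrite /dom /= => /negP; rewrite -leNgt leye_eq => /eqP.
have mulNy w c : 0 < c -> (-oo < c%:E * h w)%E.
  have [hNy _] := hp; move=> c0; move: (hNy w).
  by case: (h w) => [r||] //= _; rewrite ?ltNyr // gt0_muley ?lte_fin // ltNyy.
have [hu|/inf ->] := pselect (dom h u); last first.
  by rewrite gt0_muley ?lte_fin // addye ?leey // gt_eqF // mulNy.
have [hv|/inf ->] := pselect (dom h v); last first.
  by rewrite (gt0_muley (x := t%:E)) ?lte_fin // addey ?leey // gt_eqF // mulNy.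
have [hw le_w] := strongly_convex_fine hp hc hu hv t01.
rewrite (proper_fineE hp hw) (proper_fineE hp hu) (proper_fineE hp hv).
rewrite -!EFinM -EFinD lee_fin; apply: (le_trans le_w).
rewrite gerBl mulr_ge0 ?sqr_ge0 // !mulr_ge0 //; lra.
Qed.

Lemma dom_primal u : dom (primal_fun A f g) u <-> dom f u /\ dom g (A *m u).
Proof.
have [fNy _] := f_proper; have [gNy _] := g_proper.
rewrite /dom /primal_fun /=; split=> [|[]]; last exact: lte_add_pinfty.
move: (fNy u) (gNy (A *m u)).
by case: (f u) => [r||]; case: (g _) => [s||] //= _ _ _; rewrite !ltry.
Qed.

Lemma subdiff_primalP x b : (mulmx A @` dom f) `&` dom g !=set0 ->
  subdiff (primal_fun A f g) x b <->
  [/\ dom f x, dom g (A *m x) &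
    forall u, dom f u -> dom g (A *m u) ->
      fine (f x) + fine (g (A *m x)) + dot b (u - x) <= fine (f u) + fine (g (A *m u))].
Proof.
move=> [_ [[u0 fu0 <-] gu0]].
have primal_proper : proper_fun (primal_fun A f g).
  have [fNy _] := f_proper; have [gNy _] := g_proper.
  split=> [u|]; last by exists u0; apply/dom_primal.
  by rewrite /primal_fun ltNye adde_eq_ninfty negb_or -!ltNye fNy gNy.
have primalE u : dom f u -> dom g (A *m u) ->
    fine (primal_fun A f g u) = fine (f u) + fine (g (A *m u)).
  move=> fu gu; rewrite /primal_fun (proper_fineE f_proper fu).
  by rewrite (proper_fineE g_proper gu).
rewrite subdiffP //; split=> [[/dom_primal[fx gx] sub]|[fx gx sub]].
  split=> // u fu gu; rewrite -!primalE //.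
  by apply: sub; apply/dom_primal.
split=> [|u /dom_primal[fu gu]]; first exact/dom_primal.
by rewrite !primalE // sub.
Qed.

Hypothesis qualification :
  ([set w : 'cV[R]_m | exists v u, [/\ dom g v, dom f u & w = v - A *m u]])° 0.

Lemma qualification_feasible : (mulmx A @` dom f) `&` dom g !=set0.
Proof.
have [v [u [gv fu /esym/eqP]]] := interior_subset qualification.
by rewrite subr_eq0 => /eqP vE; exists v; split=> //; exists u.
Qed.

(** The differences [v - A u] fill a ball around 0, so upper bounds on [q] along them bound [q].
    This serves for sublevel sets of psi and for multipliers alike. *)
Lemma qualification_bounded (phi : 'cV[R]_n -> 'cV[R]_m -> R) :
  exists B, forall q,
    (forall u v, dom f u -> dom g v -> dot q (v - A *m u) <= phi u v) ->
    enorm q <= B.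
Proof.
have [rho rho0 rhoP] := nbhs_enorm qualification.
pose K w s := exists u v, [/\ dom f u, dom g v, w = v - A *m u & s = phi u v].
have K_total w : enorm w < rho -> exists s, K w s.
  rewrite -{1}[w]subr0 => /rhoP[v [u [gv fu wE]]].
  by exists (phi u v), u, v.
have [B BP] := linear_minorant_bounded rho0 K_total.
exists B => q qP; apply: BP => w s [u [v [fu gv -> ->]]]; exact: qP.
Qed.

Lemma subdiff_sum_rule x b : convex_efun f -> convex_efun g ->
  subdiff (primal_fun A f g) x b ->
  exists2 q, subdiff g (A *m x) q & subdiff f x (b - A^T *m q).
Proof.
move=> f_convex g_convex /(subdiff_primalP _ _ qualification_feasible)[fx gx sub].
(* [K] is essentially the epigraph of the value function of the problem perturbed by [w = v - A u],
   tilted by [b] and shifted by its value at [x]. Its minorant [q] is the multiplier. *)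
pose K w s := exists u v, [/\ dom f u, dom g v, w = v - A *m u &
  fine (f u) + fine (g v) - dot b (u - x) - fine (f x) - fine (g (A *m x)) <= s].
have [rho rho0 rhoP] := nbhs_enorm qualification.
have K_total w : enorm w < rho -> exists s, K w s.
  rewrite -{1}[w]subr0 => /rhoP[v [u [gv fu wE]]].
  by eexists; exists u, v; split.
have K_0 s : K 0 s -> 0 <= s.
  move=> [u [v [fu gv /esym/eqP]]]; rewrite subr_eq0 => /eqP vE le_s.
  by apply: le_trans le_s; rewrite vE in gv *; have := sub u fu gv; lra.
have K_convex w1 s1 w2 s2 t : 0 < t < 1 -> K w1 s1 -> K w2 s2 ->
    K ((1 - t) *: w1 + t *: w2) ((1 - t) * s1 + t * s2).
  move=> t01 [u1 [v1 [fu1 gv1 -> le1]]] [u2 [v2 [fu2 gv2 -> le2]]].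
  have [fu leu] := convex_fine f_proper f_convex fu1 fu2 t01.
  have [gv lev] := convex_fine g_proper g_convex gv1 gv2 t01.
  exists ((1 - t) *: u1 + t *: u2), ((1 - t) *: v1 + t *: v2); split=> //.
    rewrite mulmxDr -!scalemxAr !scalerBr; apply/colP => i; rewrite !mxE; ring.
  rewrite !dotE; rewrite !dotE in le1 le2; case/andP: t01 => t0 t1.
  rewrite -subr_ge0 in le1; rewrite -subr_ge0 in le2.
  have t1' : 0 <= 1 - t by rewrite subr_ge0 ltW.
  have := mulr_ge0 (ltW t0) le2; have := mulr_ge0 t1' le1.
  lra.
have [q qP] := linear_minorant_exists rho0 K_total K_convex K_0.
have qK u v : dom f u -> dom g v ->
    dot q (v - A *m u) <=
      fine (f u) + fine (g v) - dot b (u - x) - fine (f x) - fine (g (A *m x)).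
  by move=> fu gv; apply: qP; exists u, v.
(* Freezing [u = x] gives the subgradient of [g]; freezing [v = A x] gives that of [f]. *)
exists q.
  apply/(subdiffP _ _ g_proper); split=> // v gv.
  by have := qK x v fx gv; rewrite subrr dot0r; lra.
apply/(subdiffP _ _ f_proper); split=> // u fu.
have := qK u (A *m x) fu gx.
by rewrite dotDl dotNl dot_trmx -(opprB x u) mulmxN mulmxBr !dotE; lra.
Qed.

End SumRule.

(** * Dual error bound *)

Section ErrorBound.
Context {R : realType} {n m : nat}.
Variables (A : 'M[R]_(m, n)) (f : 'cV[R]_n -> \bar R) (g : 'cV[R]_m -> \bar R).
Variables (mu : R) (xstar : 'cV[R]_n).
Hypotheses (f_proper : proper_fun f) (g_proper : proper_fun g)
  (mu_gt0 : 0 < mu) (f_sconvex : strongly_convex mu f) (g_convex : convex_efun g)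
  (qualification :
    ([set w : 'cV[R]_m | exists v u, [/\ dom g v, dom f u & w = v - A *m u]])° 0).

Definition dual_solution (y : 'cV[R]_m) : Prop :=
  subdiff f xstar (- (A^T *m y)) /\ subdiff g (A *m xstar) y.

(** For a [dual_triple] this is [psi(y) - inf psi] by [dual_fun_attained] and strong duality, kept
    real-valued by means of the certificates [x] and [z]. *)
Definition dual_gap (y : 'cV[R]_m) (x : 'cV[R]_n) (z : 'cV[R]_m) : R :=
  dot y (z - A *m x) - fine (f x) - fine (g z)
  + (fine (f xstar) + fine (g (A *m xstar))).

Definition dual_triple (y : 'cV[R]_m) (x : 'cV[R]_n) (z : 'cV[R]_m) : Prop :=
  subdiff f x (- (A^T *m y)) /\ subdiff g z y.

Lemma dual_gap_affine_lb y x z u v : dual_triple y x z -> dom f u -> dom g v ->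
  dot y (v - A *m u) - fine (f u) - fine (g v)
    + (fine (f xstar) + fine (g (A *m xstar))) <= dual_gap y x z.
Proof.
move=> [/(subdiffP _ _ f_proper)[_ fs] /(subdiffP _ _ g_proper)[_ gs]] fu gv.
have := fs u fu; have := gs v gv.
by rewrite /dual_gap dotNl dot_trmx mulmxBr !dotE; lra.
Qed.

(** The subgradient inequalities at [x] and [z] are evaluated at [xstar] and [A xstar]; the linear
    terms cancel and strong convexity of [f] leaves the square. *)
Lemma dual_gap_growth y x z : dom f xstar -> dom g (A *m xstar) ->
  dual_triple y x z -> mu / 2 * enorm (x - xstar) ^+ 2 <= dual_gap y x z.
Proof.
move=> fxs gxs [fsub /(subdiffP _ _ g_proper)[_ gs]].
have := subdiff_strong f_proper f_sconvex fsub fxs; have := gs _ gxs.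
rewrite (enormB xstar) /dual_gap dotNl dot_trmx mulmxBr !dotE; lra.
Qed.

(** Here the roles are exchanged: the subgradients at [xstar] and [A xstar] are tested at [x] and
    [z]. *)
Lemma dual_gap_le_dot y x z ys : dual_solution ys -> dual_triple y x z ->
  dual_gap y x z <= dot (y - ys) (z - A *m x).
Proof.
move=> [/(subdiffP _ _ f_proper)[_ fs] /(subdiffP _ _ g_proper)[_ gs]].
move=> [/(subdiffP _ _ f_proper)[fx _] /(subdiffP _ _ g_proper)[gz _]].
have := fs x fx; have := gs z gz.
rewrite /dual_gap dotNl dot_trmx mulmxBr !dotE; lra.
Qed.

Hypothesis strict_compl : relint (subdiff (primal_fun A f g) xstar) 0.

Lemma xstar_dom : dom f xstar /\ dom g (A *m xstar).
Proof.
have [sub0 _] := strict_compl.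
have feas := qualification_feasible qualification.
by have [] := (iffLR (subdiff_primalP f_proper g_proper _ _ feas)) sub0.
Qed.

Lemma subdiff_split b : subdiff (primal_fun A f g) xstar b ->
  exists2 q, subdiff g (A *m xstar) q & subdiff f xstar (b - A^T *m q).
Proof.
apply: subdiff_sum_rule => //.
exact: strongly_convex_convex (ltW mu_gt0) f_sconvex.
Qed.

Lemma dual_solution_exists : exists y, dual_solution y.
Proof.
have [/subdiff_split[q gq fq] _] := strict_compl.
by exists q; split=> //; rewrite sub0r in fq.
Qed.

Lemma dual_sublevel_bounded c :
  exists B, forall y x z, dual_triple y x z -> dual_gap y x z <= c -> enorm y <= B.
Proof.
have [B BP] := qualification_bounded qualification
  (fun u v => c + fine (f u) + fine (g v) - (fine (f xstar) + fine (g (A *m xstar)))).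
exists B => y x z T le_c; apply: BP => u v fu gv.
by have := dual_gap_affine_lb T fu gv; lra.
Qed.

(** Adding the two subgradient inequalities bounds [q] along [v - A u]; the perturbation [b] costs
    at most [delta * enorm (u - xstar)]. *)
Lemma multiplier_bounded delta :
  exists B, forall b q, enorm b <= delta -> subdiff g (A *m xstar) q ->
    subdiff f xstar (b - A^T *m q) -> enorm q <= B.
Proof.
have [B BP] := qualification_bounded qualification
  (fun u v => fine (f u) + fine (g v) - (fine (f xstar) + fine (g (A *m xstar)))
     + delta * enorm (u - xstar)).
exists B => b q b_le /(subdiffP _ _ g_proper)[_ gs] /(subdiffP _ _ f_proper)[_ fs].
apply: BP => u v fu gv; have := fs u fu; have := gs v gv.
rewrite dotDl dotNl dot_trmx mulmxBr.
have := ler_norm (- dot b (u - xstar)); rewrite normrN.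
have := norm_dot_le b (u - xstar).
have := ler_wpM2r (enorm_ge0 (u - xstar)) b_le.
rewrite !(dotDr, dotNr); lra.
Qed.

(* Strict complementarity lets one step back from [s] in the sum of the
   two subdifferentials to an opposite small element of that sum, and the convex
   combination of the two is [0]. *)
Lemma dual_solution_regularity B :
  exists2 C, 0 <= C & forall y p q, enorm y <= B ->
    subdiff f xstar p -> subdiff g (A *m xstar) q ->
    exists2 ys, dual_solution ys &
      enorm (y - ys) <= C * (enorm (y - q) + enorm (- (A^T *m y) - p)).
Proof.
have [S0 [U /nbhs_enorm[e e0 eU] US]] := strict_compl.
set S := subdiff (primal_fun A f g) xstar in S0 US *.
have feas := qualification_feasible qualification.
(* As [0] is in [S], the affine hull of [S] contains every multiple of [s], negative ones
   included. *)
have S_scale s k : S s -> enorm (k *: s) < e -> S (k *: s).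
  move=> Ss small; apply: US; split; first by apply: eU; rewrite subr0.
  move=> T [T_affine ST]; have := T_affine 0 s k (ST _ S0) (ST _ Ss).
  by rewrite scaler0 add0r.
pose delta := e / 2; have delta0 : 0 < delta by rewrite divr_gt0.
have [B1 B1P] := multiplier_bounded delta.
have [y0 Y0] := dual_solution_exists.
have y0B : enorm y0 <= B1.
  have [fy0 gy0] := Y0.
  by apply: (B1P 0) => //; rewrite ?enorm0 ?ltW // sub0r.
have B10 : 0 <= B1 by apply: le_trans y0B; exact: enorm_ge0.
pose a := opnorm A^T; have a0 : 0 <= a := opnorm_ge0 _.
(* [M] bounds [|y - y0|], and also [|q - q'|] once [|y - q| < 1]. *)
pose M := 1 + `|B| + B1.
have M0 : 0 <= M by rewrite !addr_ge0.
exists (1 + M + (1 + a) * M / delta).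
  by rewrite !addr_ge0 // divr_ge0 ?mulr_ge0 ?addr_ge0 // ltW.
move=> y p q yB fp gq.
have {}yB : enorm y <= `|B| by apply: le_trans yB _; exact: ler_norm.
set E := enorm (y - q) + _.
have yqE : enorm (y - q) <= E by rewrite lerDl enorm_ge0.
have E0 : 0 <= E by rewrite addr_ge0 ?enorm_ge0.
have C0 : 0 <= (1 + a) * M / delta.
  by rewrite divr_ge0 ?mulr_ge0 ?addr_ge0 // ltW.
(* Far from [q], where [E] is at least 1, the fixed solution [y0] is close enough. *)
have [yq1|yq1] := lerP 1 (enorm (y - q)).
  exists y0 => //; apply: (@le_trans _ _ (M * E)).
    apply: (@le_trans _ _ M).
      have := enormD_le y (- y0); rewrite enormN /M; lra.
    by rewrite ler_peMr // (le_trans yq1).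
  by rewrite ler_wpM2r //; lra.
pose s := p + A^T *m q.
have sE : enorm s <= (1 + a) * E.
  have -> : s = - ((- (A^T *m y) - p) + A^T *m (y - q)).
    by rewrite mulmxBr /s; apply/colP => i; rewrite !mxE; ring.
  rewrite enormN; apply: (le_trans (enormD_le _ _)).
  rewrite mulrDl mul1r lerD //; first by rewrite lerDr enorm_ge0.
  by apply: (le_trans (opnorm_ub _ _)); rewrite ler_wpM2l.
have [s0|s0] := eqVneq (enorm s) 0.
  exists q.
    split=> //; have <- : p = - (A^T *m q); last exact: fp.
    by apply/eqP; rewrite -addr_eq0; apply/eqP/enorm_eq0.
  apply: (le_trans yqE); rewrite ler_peMl //; lra.
have {}s0 : 0 < enorm s by rewrite lt0r s0 enorm_ge0.
have Ss : S s.
  have [fx fs] := (iffLR (subdiffP _ _ f_proper)) fp.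
  have [gx gs] := (iffLR (subdiffP _ _ g_proper)) gq.
  apply/(subdiff_primalP f_proper g_proper _ _ feas); split=> // u fu gu.
  have := fs u fu; have := gs _ gu.
  by rewrite /s dotDl dot_trmx mulmxBr; lra.
pose k := - (delta / enorm s).
have kN : enorm (k *: s) = delta.
  rewrite enormZ normrN ger0_norm; last by rewrite divr_ge0 // ltW.
  by rewrite divfK // gt_eqF.
have Sk : S (k *: s) by apply: S_scale => //; rewrite kN /delta; lra.
have [q' gq' fq'] := subdiff_split Sk.
have q'B : enorm q' <= B1 by apply: B1P gq' fq'; rewrite kN.
pose t := enorm s / (delta + enorm s).
have dsp : 0 < delta + enorm s by rewrite addr_gt0.
have t01 : 0 < t < 1.
  by rewrite divr_gt0 //= ltr_pdivrMr // mul1r ltrDr.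
have cancel : (1 - t) + t * k = 0.
  by rewrite /t /k; field; rewrite !gt_eqF.
exists ((1 - t) *: q + t *: q').
  split; last exact: subdiff_convex.
  have -> : - (A^T *m ((1 - t) *: q + t *: q')) =
            (1 - t) *: p + t *: (k *: s - A^T *m q').
    rewrite mulmxDr -!scalemxAr.
    have -> : p = s - A^T *m q by rewrite addrK.
    rewrite scalerBr scalerBr scalerA addrACA -scalerDl cancel scale0r add0r.
    by rewrite opprD.
  exact: subdiff_convex.
have -> : y - ((1 - t) *: q + t *: q') = (y - q) + t *: (q - q').
  by apply/colP => i; rewrite !mxE; ring.
apply: (le_trans (enormD_le _ _)).
have /andP[t0 _] := t01.
have tE : t <= (1 + a) * E / delta.
  apply: (@le_trans _ _ (enorm s / delta)); last by rewrite ler_pM2r ?invr_gt0.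
  by rewrite ler_pM2l // lef_pV2 ?posrE // lerDl ltW.
have qq' : enorm (q - q') <= M.
  have := enormD_le q (- q'); rewrite enormN.
  have := enorm_triangle y q 0; rewrite !subr0 (enormB q y) /M; lra.
have tq : t * enorm (q - q') <= (1 + a) * E / delta * M.
  by apply: ler_pM => //; [exact: ltW | exact: enorm_ge0].
have cE : (1 + a) * E / delta * M = (1 + a) * M / delta * E by ring.
rewrite cE in tq; rewrite enormZ gtr0_norm //.
by have := mulr_ge0 M0 E0; lra.
Qed.

Hypotheses (f_calm : calm_at (subdiff f) xstar)
  (g_calm : calm_at (subdiff g) (A *m xstar)).

Lemma calm_enorm p q (H : 'cV[R]_p -> set 'cV[R]_q) xb yb :
  calm_at H yb -> H yb xb ->
  exists e k, [/\ 0 < e, 0 <= k & forall y x, H y x -> enorm (x - xb) < e ->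
    exists2 x', H yb x' & enorm (x - x') <= k * enorm (y - yb)].
Proof.
move=> calm Hxb; have [U /nbhs_enorm[e e0 eU] [k k0 kP]] := calm xb Hxb.
by exists e, k; split=> // y x Hyx /eU Ux; apply: kP.
Qed.

Lemma dual_local_error_bound yb : dual_solution yb ->
  exists e C, 0 < e /\ forall y x z, dual_triple y x z -> enorm (y - yb) < e ->
    dual_gap y x z <= C * enorm (z - A *m x) ^+ 2.
Proof.
move=> [fyb gyb].
have [e1 [k1 [e10 k10 k1P]]] := calm_enorm f_calm fyb.
have [e2 [k2 [e20 k20 k2P]]] := calm_enorm g_calm gyb.
pose aT := opnorm A^T; have aT0 : 0 <= aT := opnorm_ge0 _.
pose a := opnorm A; have a0 : 0 <= a := opnorm_ge0 _.
pose e := Num.min (e1 / (aT + 1)) e2.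
have aT1 : 0 < aT + 1 by rewrite ltr_wpDl.
have e0 : 0 < e by rewrite lt_min e20 divr_gt0.
have [C0 C00 C0P] := dual_solution_regularity (enorm yb + e).
have [fxs gxs] := xstar_dom.
pose K := C0 * (k1 + k2 + k2 * a).
have K0 : 0 <= K by rewrite mulr_ge0 // !addr_ge0 // mulr_ge0.
pose C := 1 + 2 * K ^+ 2 * (1 + 2 / mu).
exists e, C; split=> // y x z T yyb; have [fy gy] := T.
have yB : enorm y <= enorm yb + e.
  by have := enorm_triangle yb y 0; rewrite !subr0; lra.
have [p fp pP] : exists2 p, subdiff f xstar p &
    enorm (- (A^T *m y) - p) <= k1 * enorm (x - xstar).
  apply: k1P => //; rewrite -opprD enormN -mulmxBr.
  apply: (le_lt_trans (opnorm_ub _ _)).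
  apply: (@le_lt_trans _ _ ((aT + 1) * enorm (y - yb))).
    by rewrite ler_wpM2r ?enorm_ge0 // lerDl.
  by rewrite mulrC -ltr_pdivlMr // (lt_le_trans yyb) // ge_min lexx.
have [q gq qP] : exists2 q, subdiff g (A *m xstar) q &
    enorm (y - q) <= k2 * enorm (z - A *m xstar).
  by apply: k2P => //; rewrite (lt_le_trans yyb) // ge_min lexx orbT.
have [ys Ys ysP] := C0P y p q yB fp gq.
set W := enorm (z - A *m x); set X := enorm (x - xstar) in pP.
set D := enorm (y - ys) in ysP.
have W0 : 0 <= W := enorm_ge0 _; have X0 : 0 <= X := enorm_ge0 _.
have D0 : 0 <= D := enorm_ge0 _.
have zW : enorm (z - A *m xstar) <= W + a * X.
  apply: (le_trans (enorm_triangle (A *m x) _ _)); rewrite lerD2l -mulmxBr.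
  exact: opnorm_ub.
have DK : D <= K * (W + X).
  apply: (le_trans ysP); rewrite /K -mulrA ler_wpM2l //.
  have := ler_wpM2l k20 zW.
  have := mulr_ge0 k10 W0; have := mulr_ge0 k20 X0.
  have := mulr_ge0 (mulr_ge0 k20 a0) W0; lra.
have gapDW : dual_gap y x z <= D * W.
  exact: le_trans (dual_gap_le_dot Ys T) (dot_le_enorm _ _).
(* Growth turns the bound [D * W] on the gap into one on the primal error [X], so that
   [D <= K (W + X)] becomes a quadratic inequality in [D]. *)
have X2 : X ^+ 2 <= 2 / mu * (D * W).
  have h := le_trans (dual_gap_growth fxs gxs T) gapDW.
  have := ler_wpM2l (ltW (divr_gt0 (ltr0n _ 2) mu_gt0)) h; rewrite -/X.
  by have -> : 2 / mu * (mu / 2 * X ^+ 2) = X ^+ 2 by field; rewrite gt_eqF.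
suff DC : D <= C * W.
  by apply: (le_trans gapDW); rewrite expr2 mulrA ler_wpM2r.
(* If [D > C W], then [W <= D] and [D^2 <= 2 K^2 (W^2 + X^2) <= (C - 1) W D], a contradiction. *)
rewrite leNgt; apply/negP => CD.
have mu2 : 0 <= 2 / mu by rewrite divr_ge0 // ltW.
have C1 : 1 <= C.
  have := mulr_ge0 (mulr_ge0 (ler0n R 2) (sqr_ge0 K)) (addr_ge0 ler01 mu2).
  by rewrite /C; lra.
have WD : W <= D by apply: le_trans (ltW CD); rewrite ler_peMl.
have D2 : D ^+ 2 <= 2 * K ^+ 2 * (1 + 2 / mu) * W * D.
  apply: (@le_trans _ _ (K ^+ 2 * (W + X) ^+ 2)).
    have KWX : 0 <= K * (W + X) by apply: mulr_ge0 => //; exact: addr_ge0.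
    by rewrite -exprMn; apply: lerXn2r DK; rewrite nnegrE.
  apply: (@le_trans _ _ (K ^+ 2 * (2 * (W ^+ 2 + 2 / mu * (D * W))))).
    rewrite ler_wpM2l ?sqr_ge0 //; have := sqr_ge0 (W - X); nra.
  have WWD : W ^+ 2 <= W * D by rewrite expr2 ler_wpM2l.
  have := ler_wpM2l (mulr_ge0 (ler0n R 2) (sqr_ge0 K)) WWD; lra.
have Dp : 0 < D by apply: le_lt_trans CD; rewrite mulr_ge0 // (le_trans ler01).
rewrite expr2 ler_pM2r // in D2.
by move: CD; rewrite /C mulrDl mul1r; lra.
Qed.

Lemma dual_error_bound : exists N : nat, forall y x z, dual_triple y x z ->
  dual_gap y x z <= N.+1%:R^-1 -> dual_gap y x z <= N%:R * enorm (z - A *m x) ^+ 2.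
Proof.
have [B BP] := dual_sublevel_bounded 1.
pose P N y := forall x z, dual_triple y x z -> dual_gap y x z <= N.+1%:R^-1 ->
  dual_gap y x z <= N%:R * enorm (z - A *m x) ^+ 2.
suff locP (y0 : 'cV[R]_m) : exists e N0, 0 < e /\
    forall N (y : 'cV[R]_m), (N0 <= N)%N -> enorm (y - y0) < e -> P N y.
  have [N NP] := enorm_ball_covering B locP; exists N => y x z T gapN.
  apply: NP => //; apply: (BP y x z) => //; apply: (le_trans gapN).
  by rewrite invf_le1 ?ler1n.
have [Y0|nY0] := pselect (dual_solution y0).
  have [e [C [e0 CP]]] := dual_local_error_bound Y0.
  exists e, (Num.truncn C).+1; split=> // N y CN yy0 x z T _.
  apply: (le_trans (CP _ _ _ T yy0)); rewrite ler_wpM2r ?sqr_ge0 //.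
  by apply: (le_trans (ltW (truncnS_gt C))); rewrite ler_nat.
(* Away from solutions some affine minorant of the gap is positive at [y0]. It keeps the gap above
   [eta / 2] nearby, so for large [N] the smallness hypothesis fails there. *)
have [u [v [fu gv gap0]]] : exists u v, [/\ dom f u, dom g v &
    0 < dot y0 (v - A *m u) - fine (f u) - fine (g v)
        + (fine (f xstar) + fine (g (A *m xstar)))].
  apply: contrapT => no; apply: nY0.
  have {}no u v : dom f u -> dom g v ->
      dot y0 (v - A *m u) - fine (f u) - fine (g v)
        + (fine (f xstar) + fine (g (A *m xstar))) <= 0.
    by move=> fu gv; rewrite leNgt; apply/negP => h; apply: no; exists u, v.
  have [fxs gxs] := xstar_dom; split.
    apply/(subdiffP _ _ f_proper); split=> // u fu; have := no u _ fu gxs.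
    by rewrite dotNl dot_trmx mulmxBr !dotE; lra.
  apply/(subdiffP _ _ g_proper); split=> // v gv; have := no _ v fxs gv.
  by lra.
set eta := dot _ _ - _ - _ + _ in gap0.
pose b := enorm (v - A *m u); have b0 : 0 <= b := enorm_ge0 _.
exists (eta / 2 / (b + 1)), (Num.truncn (2 / eta)).+1.
have b1 : 0 < b + 1 by rewrite ltr_wpDl.
split=> [|N y NN yy0 x z T gapN]; first by rewrite !divr_gt0.
have lb := dual_gap_affine_lb T fu gv.
have close : dot y0 (v - A *m u) - dot y (v - A *m u) <= eta / 2.
  rewrite -dotNl -dotDl; apply: (le_trans (dot_le_enorm _ _)).
  rewrite enormB -/b; apply: (@le_trans _ _ (eta / 2 / (b + 1) * (b + 1))).
    by rewrite ler_pM ?enorm_ge0 ?ltW // ltrDl.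
  by rewrite divfK // gt_eqF.
have small : N.+1%:R^-1 < eta / 2.
  rewrite -[eta / 2]invf_div ltf_pV2 ?posrE ?divr_gt0 //.
  by apply: (lt_le_trans (Num.Theory.truncnS_gt _)); rewrite ler_nat leqW.
have gap_lt := le_lt_trans gapN small; exfalso.
by move: lb close gap_lt; rewrite /eta; lra.
Qed.

End ErrorBound.

(** * One iteration *)

Section Step.
Context {R : realType} {n m : nat}.
Variables (A : 'M[R]_(m, n)) (f : 'cV[R]_n -> \bar R) (g : 'cV[R]_m -> \bar R).
Variables (mu gamma : R) (xstar : 'cV[R]_n).
Hypotheses (f_proper : proper_fun f) (g_proper : proper_fun g)
  (mu_gt0 : 0 < mu) (f_sconvex : strongly_convex mu f) (g_convex : convex_efun g)
  (gamma_gt0 : 0 < gamma) (gamma_lt : gamma * opnorm A ^+ 2 < mu).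

Definition augL_real (x : 'cV[R]_n) (z y : 'cV[R]_m) : R :=
  fine (f x) + fine (g z)
  + (dot y (A *m x - z) + gamma / 2 * enorm (A *m x - z) ^+ 2).

Lemma primal_update_subdiff y x z : primal_update A f g gamma y x z ->
  subdiff f x (- (A^T *m y)) /\ subdiff g z (y + gamma *: (A *m x - z)).
Proof.
move=> [xmin zmin]; have fx := argmin_lagrangian_subdiff f_proper xmin.
split=> //; apply: argmin_augL_subdiff zmin => //.
by have [] := (iffLR (subdiffP _ _ f_proper)) fx.
Qed.

(** The certificates come from different updates: [z] from the one at [y], since its optimality
    condition already involves the new multiplier, and [x'] from the one at the new multiplier. *)
Lemma dual_step_triple y x z x' z' :
  primal_update A f g gamma y x z ->
  primal_update A f g gamma (y + gamma *: (A *m x - z)) x' z' ->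
  dual_triple A f g (y + gamma *: (A *m x - z)) x' z.
Proof. by move=> /primal_update_subdiff[_ gz] /primal_update_subdiff[fx' _]. Qed.

Lemma dual_step_decrease y x z x' z' :
  primal_update A f g gamma y x z ->
  primal_update A f g gamma (y + gamma *: (A *m x - z)) x' z' ->
  dual_gap A f g xstar (y + gamma *: (A *m x - z)) x' z <=
    fine (f xstar) + fine (g (A *m xstar)) - augL_real x z y
    - gamma / 2 * (1 - gamma * opnorm A ^+ 2 / mu) * enorm (A *m x - z) ^+ 2.
Proof.
move=> /primal_update_subdiff[fx gz] /primal_update_subdiff[fx' _].
have [dx' _] := (iffLR (subdiffP _ _ f_proper)) fx'.
have := subdiff_strong f_proper f_sconvex fx dx'.
rewrite /dual_gap /augL_real dotNl dot_trmx.
set r := A *m x - z; set d := enorm (x' - x); set a := opnorm A.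
have rz : z - A *m x' = - r - A *m (x' - x).
  by rewrite /r mulmxBr; apply/colP => i; rewrite !mxE; ring.
have : - dot r (A *m (x' - x)) <= enorm r * (a * d).
  apply: (le_trans (ler_norm _)); rewrite normrN.
  by apply: (le_trans (norm_dot_le _ _)); rewrite ler_wpM2l ?enorm_ge0 ?opnorm_ub.
rewrite rz; clearbody r; rewrite !dotE -enorm_sqr.
move: (dot r _) (dot y r) (dot y _) (enorm r) => rA yr yA e.
move=> rA_le le_f.
(* Completing the square in [d] absorbs the cross term into the strong convexity of [f]. *)
have young : gamma * (e * (a * d)) - mu / 2 * d ^+ 2 <=
    gamma / 2 * (gamma * a ^+ 2 / mu) * e ^+ 2.
  rewrite -subr_ge0.
  have -> : gamma / 2 * (gamma * a ^+ 2 / mu) * e ^+ 2 -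
      (gamma * (e * (a * d)) - mu / 2 * d ^+ 2) =
      mu / 2 * (d - gamma * a * e / mu) ^+ 2 by field; rewrite gt_eqF.
  by rewrite mulr_ge0 ?sqr_ge0 // divr_ge0 // ltW.
have := ler_wpM2l (ltW gamma_gt0) rA_le.
move: young; lra.
Qed.

(** This says that the envelope lies below psi: test the subgradient of [g] at [zp] against [z] and
    drop the penalty. *)
Lemma augL_dual_gap y x z zp :
  dual_triple A f g y x zp -> dom g z ->
  fine (f xstar) + fine (g (A *m xstar)) - augL_real x z y <=
    dual_gap A f g xstar y x zp.
Proof.
move=> [_ /(subdiffP _ _ g_proper)[_ gs]] gz; have := gs z gz.
have := mulr_ge0 (divr_ge0 (ltW gamma_gt0) (ler0n R 2)) (sqr_ge0 (enorm (A *m x - z))).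
rewrite /dual_gap /augL_real !(dotDr, dotNr); lra.
Qed.

(** The error bound involves [z - A x'], the decrease [A x - z]. Strong monotonicity of the
    subdifferential of [f] gives [mu d <= gamma a |r|], whence [a d <= |r|]. *)
Lemma dual_step_residual y x z x' z' :
  primal_update A f g gamma y x z ->
  primal_update A f g gamma (y + gamma *: (A *m x - z)) x' z' ->
  enorm (z - A *m x') <= 2 * enorm (A *m x - z).
Proof.
move=> /primal_update_subdiff[fx gz] /primal_update_subdiff[fx' _].
have [dx' _] := (iffLR (subdiffP _ _ f_proper)) fx'.
have [dx _] := (iffLR (subdiffP _ _ f_proper)) fx.
have := subdiff_strong f_proper f_sconvex fx dx'.
have := subdiff_strong f_proper f_sconvex fx' dx.
rewrite (enormB x x') -(opprB x' x) !dotNl dotNr !dot_trmx dotDl dotZl.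
set r := A *m x - z; set d := enorm (x' - x); set a := opnorm A.
move=> le1 le2.
have : - dot r (A *m (x' - x)) <= enorm r * (a * d).
  apply: (le_trans (ler_norm _)); rewrite normrN.
  by apply: (le_trans (norm_dot_le _ _)); rewrite ler_wpM2l ?enorm_ge0 ?opnorm_ub.
move=> /(ler_wpM2l (ltW gamma_gt0)) rA_le.
have r0 : 0 <= enorm r := enorm_ge0 _.
have d0 : 0 <= d := enorm_ge0 _.
have a0 : 0 <= a := opnorm_ge0 _.
have mud2 : mu * d * d <= gamma * a * enorm r * d by move: rA_le le1 le2; lra.
have mud : mu * d <= gamma * a * enorm r.
  have [d00|dn0] := eqVneq d 0; last by rewrite -(ler_pM2r (x := d)) // lt0r dn0.
  by rewrite d00 mulr0 !mulr_ge0 // ltW.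
have ad : a * d <= enorm r.
  rewrite -(ler_pM2l mu_gt0) mulrCA; apply: (le_trans (ler_wpM2l a0 mud)).
  have -> : a * (gamma * a * enorm r) = gamma * a ^+ 2 * enorm r by ring.
  by rewrite ler_wpM2r // ltW.
have -> : z - A *m x' = - (r + A *m (x' - x)).
  by rewrite /r mulmxBr; apply/colP => i; rewrite !mxE; ring.
rewrite enormN; apply: (le_trans (enormD_le _ _)).
by have := opnorm_ub A (x' - x); rewrite -/a -/d; lra.
Qed.

Lemma accepted_augL y d x z tau yt xt zt :
  primal_update A f g gamma y x z -> accepted A f g gamma y d x z tau yt xt zt ->
  dom g z /\ augL_real x z y <= augL_real xt zt yt.
Proof.
move=> /primal_update_subdiff[/(subdiffP _ _ f_proper)[fx _]].
move=> /(subdiffP _ _ g_proper)[gz _] [_ /primal_update_subdiff[]].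
move=> /(subdiffP _ _ f_proper)[fxt _] /(subdiffP _ _ g_proper)[gzt _].
rewrite /augL (proper_fineE f_proper fx) (proper_fineE f_proper fxt).
by rewrite (proper_fineE g_proper gz) (proper_fineE g_proper gzt) -!EFinD lee_fin.
Qed.

End Step.

(** * Rates *)

Section Rates.
Context {R : realType}.

(** A limit [l] exists by monotonicity, and passing to the limit yields [l^2 <= K (l - l) = 0]. *)
Lemma nonincreasing_sqr_cvg0 (b : nat -> R) (K : R) :
  (forall k, 0 <= b k) -> (forall k, b k.+1 <= b k) ->
  (forall k, b k.+1 ^+ 2 <= K * (b k - b k.+1)) -> b @ \oo --> 0.
Proof.
move=> b0 b_decr b_sqr.
have : cvgn b.
  apply: nonincreasing_is_cvgn; first exact/nonincreasing_seqP.
  by exists 0 => _ [k _ <-].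
move=> /cvg_ex[l /= bl].
have bl' : b k.+1 @[k --> \oo] --> l by rewrite (cvg_shiftS b).
have l2 : l * l <= K * (l - l).
  apply: (ler_cvg_to (cvgM bl' bl') (cvgM (cvg_cst K) (cvgB bl bl'))).
  by apply: nearW => k; exact: (b_sqr k).
suff -> : 0 = l by [].
apply/eqP; rewrite eq_sym -sqrf_eq0 eq_le sqr_ge0 andbT expr2.
by rewrite subrr mulr0 in l2.
Qed.

Lemma Qlinear_cvg_sqrt (b : nat -> R) (c : R) :
  (forall k, 0 <= b k) ->
  Qlinear_cvg (fun k => (b k)%:E) 0 -> 0 < c ->
  Qlinear_cvg (fun k => (Num.sqrt (c * b k))%:E) 0.
Proof.
move=> b0 [/fine_cvg/= b_cvg [q /andP[q0 q1] [K KP]]] c0; split.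
  apply: cvg_EFin; first exact: nearW.
  have -> : 0 = Num.sqrt (c * 0) :> R by rewrite mulr0 sqrtr0.
  apply: continuous_cvg; first exact: sqrt_continuous.
  exact: cvgM (cvg_cst c) b_cvg.
exists (Num.sqrt q); first by rewrite sqrtr_gt0 q0 -sqrtr1 ltr_sqrt.
exists K => k /KP; rewrite !sube0 -!EFinM !lee_fin => le_b.
rewrite -sqrtrM; last exact: ltW.
rewrite ler_sqrt; last by rewrite !mulr_ge0 // ltW.
by rewrite mulrCA ler_wpM2l // ltW.
Qed.
Lemma Qlinear_cvg_of_decrease (b : nat -> R) (C : R) (K : nat) :
  0 <= C -> (forall k, 0 <= b k) -> b @ \oo --> 0 ->
  (forall k, (K <= k)%N -> b k.+1 <= C * (b k - b k.+1)) ->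
  Qlinear_cvg (fun k => (b k)%:E) 0.
Proof.
move=> C0 b0 b_cvg b_le; split; first by apply: cvg_EFin b_cvg; exact: nearW.
have C2 : 0 < C + 2 by rewrite ltr_wpDl.
(* The natural ratio [C / (C + 1)] vanishes when [C = 0], whereas the rate must be positive. *)
exists ((C + 1) / (C + 2)).
  by rewrite divr_gt0 ?ltr_wpDl //= ltr_pdivrMr // mul1r ltrD2l ltr1n.
exists K => k /b_le bk; rewrite !sube0 -EFinM lee_fin.
rewrite mulrAC ler_pdivlMr //; have := b0 k; have := b0 k.+1.
have : 0 <= b k - b k.+1 \/ C = 0.
  have [->|Cn0] := eqVneq C 0; [by right | left].
  rewrite -(pmulr_rge0 (x := C)); first exact: le_trans (b0 _) bk.
  by rewrite lt0r Cn0.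
case=> [|C00]; first lra.
by rewrite C00 mul0r in bk *; lra.
Qed.

(** The term [u 0] is left free because psi may be infinite at the starting point. *)
Lemma Qlinear_cvg_shift (u : nat -> \bar R) (b : nat -> R) (l : R) :
  (forall k, u k.+1 = (b k + l)%:E) ->
  Qlinear_cvg (fun k => (b k)%:E) 0 -> Qlinear_cvg u l%:E.
Proof.
move=> uE [/fine_cvg/= b_cvg [c c01 [K KP]]]; split.
  rewrite -(cvg_shiftS u) /=; under eq_fun do rewrite uE.
  apply: cvg_EFin; first exact: nearW.
  by rewrite -[X in _ --> X]add0r; exact: cvgD b_cvg (cvg_cst l).
exists c => //; exists K.+1 => -[//|k] Kk.
by rewrite !uE -!EFinB !addrK; have := KP k Kk; rewrite !sube0.
Qed.

End Rates.

(** * Convergence rates of the generated sequences *)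

Theorem mainTheorem4 (R : realType) (n m : nat) (A : 'M[R]_(m, n))
    (f : 'cV[R]_n -> \bar R) (g : 'cV[R]_m -> \bar R) (mu gamma beta : R)
    (xstar : 'cV[R]_n)
    (y d : nat -> 'cV[R]_m) (x : nat -> 'cV[R]_n) (z : nat -> 'cV[R]_m)
    (tau : nat -> R)
    (yt : nat -> 'cV[R]_m) (xt : nat -> 'cV[R]_n) (zt : nat -> 'cV[R]_m)
    (f_proper : proper_fun f) (f_closed : lower_semicontinuous f)
    (mu_gt0 : 0 < mu) (f_strongly_convex : strongly_convex mu f)
    (g_proper : proper_fun g) (g_closed : lower_semicontinuous g)
    (g_convex : convex_efun g)
    (feasible : (mulmx A @` dom f) `&` dom g !=set0)
    (xstar_min : argmin (primal_fun A f g) xstar)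
    (qualification :
      ([set w : 'cV[R]_m | exists v u, [/\ dom g v, dom f u & w = v - A *m u]])° 0)
    (strict_compl : relint (subdiff (primal_fun A f g) xstar) 0)
    (f_calm : calm_at (subdiff f) xstar)
    (g_calm : calm_at (subdiff g) (A *m xstar))
    (gamma_gt0 : 0 < gamma)
    (* gamma < mu / opnorm A ^+ 2, where the bound is +oo when A = 0 *)
    (gamma_lt : gamma * opnorm A ^+ 2 < mu)
    (beta_itv : 0 < beta < 1)
    (generated : NAMA A f g gamma beta y d x z tau yt xt zt) :
  Qlinear_cvg (fun k => dual_fun A f g (y k)) (ereal_inf (range (dual_fun A f g))) /\
  Rlinear_cvg x xstar.
Proof.
have [fxs gxs] := xstar_dom f_proper g_proper qualification strict_compl.
have [ys Ys] := dual_solution_exists f_proper g_proper mu_gt0 f_strongly_convex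
  g_convex qualification strict_compl.
set pstar := fine (f xstar) + fine (g (A *m xstar)).
(* Strong duality: [ys] attains the lower bound given by weak duality at [xstar]. *)
have infE : ereal_inf (range (dual_fun A f g)) = (- pstar)%:E.
  apply/eqP; rewrite eq_le; apply/andP; split.
    apply: ereal_inf_lbound; exists ys => //; have [fys gys] := Ys.
    by rewrite (dual_fun_attained f_proper g_proper fys gys) subrr dot0r sub0r opprD.
  apply: le_ereal_inf_tmp => _ [w _ <-].
  have := dual_fun_lb A f_proper g_proper w fxs gxs.
  by rewrite subrr dot0r sub0r -opprD.
pose r k := enorm (A *m xt k - zt k).
(* The gap at [y k.+1]: only iterates produced by a proximal gradient step come with a
   [dual_triple]. *)
pose b k := dual_gap A f g xstar (y k.+1) (x k.+1) (zt k).
have yE k : y k.+1 = yt k + gamma *: (A *m xt k - zt k).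
  exact: (NAMA_dual (generated k)).
have updt k : primal_update A f g gamma (yt k) (xt k) (zt k).
  by have [] := NAMA_accepted (generated k).
have updS k : primal_update A f g gamma
    (yt k + gamma *: (A *m xt k - zt k)) (x k.+1) (z k.+1).
  by rewrite -yE; exact: (NAMA_primal (generated k.+1)).
have T k : dual_triple A f g (y k.+1) (x k.+1) (zt k).
  by rewrite yE; exact: (dual_step_triple f_proper g_proper g_convex (updt k) (updS k)).
have b0 k : 0 <= b k.
  apply: le_trans (dual_gap_growth f_proper g_proper f_strongly_convex fxs gxs (T k)).
  by rewrite mulr_ge0 ?sqr_ge0 // divr_ge0 // ltW.
pose c := gamma / 2 * (1 - gamma * opnorm A ^+ 2 / mu).
have c0 : 0 < c.
  by rewrite mulr_gt0 ?divr_gt0 // subr_gt0 ltr_pdivrMr // mul1r.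
(* Chain: psi at [y k.+1] dominates the envelope there, acceptance does not increase the envelope,
   and the proximal gradient step goes below it. *)
have descent k : c * r k.+1 ^+ 2 <= b k - b k.+1.
  have [gz le_L] := accepted_augL f_proper g_proper g_convex
    (NAMA_primal (generated k.+1)) (NAMA_accepted (generated k.+1)).
  have := augL_dual_gap xstar g_proper gamma_gt0 (T k) gz.
  have := dual_step_decrease xstar f_proper g_proper mu_gt0 f_strongly_convex
    g_convex gamma_gt0 (updt k.+1) (updS k.+1).
  rewrite -yE -/(b k) -/(b k.+1) -/(r k.+1) -/c; lra.
have resid k : enorm (zt k - A *m x k.+1) <= 2 * r k.
  exact: (dual_step_residual f_proper g_proper mu_gt0 f_strongly_convex
    g_convex gamma_gt0 gamma_lt (updt k) (updS k)).
have r0 k : 0 <= r k by exact: enorm_ge0.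
have b_decr k : b k.+1 <= b k.
  by rewrite -subr_ge0; apply: le_trans (descent k); rewrite mulr_ge0 ?sqr_ge0 // ltW.
have b_le0 k : b k <= b 0%N.
  by elim: k => // k; apply: le_trans.
have [B BP] := dual_sublevel_bounded xstar f_proper g_proper qualification (b 0%N).
have yB k : enorm (y k.+1) <= B by apply: BP (T k) (b_le0 k).
have B0 : 0 <= B by apply: le_trans (yB 0%N); exact: enorm_ge0.
pose M := 2 * (B + enorm ys).
have M0 : 0 <= M by rewrite mulr_ge0 // addr_ge0 // enorm_ge0.
have b_r k : b k <= M * r k.
  apply: (le_trans (dual_gap_le_dot f_proper g_proper Ys (T k))).
  apply: (le_trans (dot_le_enorm _ _)).
  have -> : M * r k = (B + enorm ys) * (2 * r k) by rewrite /M; ring.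
  apply: ler_pM; [exact: enorm_ge0 | exact: enorm_ge0 | | exact: resid].
  by apply: (le_trans (enormD_le _ _)); rewrite enormN lerD2r.
(* Convergence without a rate comes first, from the crude bound [b_r]; it brings the gap below the
   threshold where the error bound applies. *)
have b_cvg : b @ \oo --> 0.
  apply: (nonincreasing_sqr_cvg0 (K := M ^+ 2 / c)) => // k.
  apply: (@le_trans _ _ (M ^+ 2 * r k.+1 ^+ 2)).
    by rewrite -exprMn; apply: lerXn2r (b_r _); rewrite nnegrE // mulr_ge0.
  rewrite -mulrA ler_wpM2l ?sqr_ge0 // mulrC ler_pdivlMr // mulrC.
  exact: descent.
have [N NP] := dual_error_bound f_proper g_proper mu_gt0 f_strongly_convex
  g_convex qualification strict_compl f_calm g_calm.
have [K _ KP] : \forall k \near \oo, b k <= N.+1%:R^-1.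
  have N0 : 0 < N.+1%:R^-1 :> R by rewrite invr_gt0.
  move/cvgrPdist_le/(_ _ N0) : b_cvg; apply: filterS => k.
  by rewrite sub0r normrN ger0_norm.
have b_Q : Qlinear_cvg (fun k => (b k)%:E) 0.
  apply: (Qlinear_cvg_of_decrease (C := N%:R * 4 / c) (K := K)) => //.
    by apply: divr_ge0 (ltW c0); rewrite mulr_ge0 ?ler0n.
  move=> k Kk; apply: (le_trans (NP _ _ _ (T k.+1) (KP _ (leqW Kk)))).
  rewrite -!mulrA ler_wpM2l //.
  apply: (@le_trans _ _ (4 * r k.+1 ^+ 2)).
    have -> : 4 * r k.+1 ^+ 2 = (2 * r k.+1) ^+ 2 by ring.
    by apply: lerXn2r (resid _); rewrite nnegrE ?enorm_ge0 // mulr_ge0.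
  rewrite ler_wpM2l // mulrC ler_pdivlMr // mulrC.
  exact: descent.
rewrite infE; split.
  apply: Qlinear_cvg_shift b_Q => k; have [fy gy] := T k.
  rewrite (dual_fun_attained f_proper g_proper fy gy).
  by rewrite /b /dual_gap -/pstar addrK.
(* By quadratic growth [b k] controls [x k.+1], hence the predecessor; index 0 is excluded below. *)
exists (fun k => Num.sqrt (2 / mu * b k.-1)).
  apply: (Qlinear_cvg_shift (b := fun k => Num.sqrt (2 / mu * b k))).
    by move=> k; rewrite addr0.
  exact: (Qlinear_cvg_sqrt b0 b_Q (divr_gt0 (ltr0n _ 2) mu_gt0)).
exists 1%N => -[//|k] _.
rewrite -[leLHS]ger0_norm ?enorm_ge0 // -sqrtr_sqr; apply: ler_wsqrtr.
have := dual_gap_growth f_proper g_proper f_strongly_convex fxs gxs (T k).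
have mu2 : 0 <= 2 / mu by rewrite divr_ge0 // ltW.
move=> /(ler_wpM2l mu2).
by have -> e : 2 / mu * (mu / 2 * e) = e :> R by field; rewrite gt_eqF.
Qed.
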